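(* Let $X$ be a topological space and let $\mathcal{S}$ be a family of closed subsets of $X$. (1) If $\mathcal{S}$ is exceedingly rich, then there exists $\mathcal{S}_0\subset\mathcal{S}$ which is large in the sense of Skolem-like functions. (2) If $X$ is metrizable and $\mathcal{S}$ is large in the sense of Skolem-like functions, then there exists $\mathcal{S}_0\subset\mathcal{S}$ which is exceedingly rich.
   Context: For a set $I$, $\mathcal{P}(I)$ is its power set and $|I|$ its cardinality. For a topological space $Z$, $\operatorname{dens}Z$ is the least cardinality of a dense subset, and $\omega$ is the first infinite cardinal. A nonempty family $\mathcal{A}$ of sets is up-directed if for all $A,B\in\mathcal{A}$ there is $C\in\mathcal{A}$ with $A\cup B\subset C$. A family $\mathcal{S}$ of closed subsets of a topological space $X$ is exceedingly rich if: (R-a) for every $Y\subset X$ there is $S\in\mathcal{S}$ with $Y\subset S$ and $\max\{\operatorname{dens}Y,\omega\}=\max\{\operatorname{dens}S,\omega\}$; (R-b) if $\mathcal{A}\subset\mathcal{S}$ is up-directed, then $\overline{\bigcup\mathcal{A}}\in\mathcal{S}$. A function $\phi:\mathcal{P}(I)\to\mathcal{P}(I)$ is Skolem-like if: (S-a) $A\subset\phi(A)$ and $|\phi(A)|\le\max\{|A|,\omega\}$ for every $A\subset I$; (S-b) $A\subset B\subset I$ implies $\phi(A)\subset\phi(B)$; (S-c) for every up-directed family $\mathcal{A}\subset\mathcal{P}(I)$, $\phi(\bigcup\mathcal{A})=\bigcup_{A\in\mathcal{A}}\phi(A)$. A family $\mathcal{S}$ of closed subsets of a topological space $X$ is large in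 the sense of Skolem-like functions if there is a Skolem-like function $\phi:\mathcal{P}(X)\to\mathcal{P}(X)$ with $\mathcal{S}=\{\overline{\phi(C)}: C\subset X\}$. *)

(* Defs.v *)
From HB Require Import structures.
From mathcomp Require Import all_boot all_order all_algebra.
From mathcomp Require Import all_classical all_reals topology.

Set Implicit Arguments.
Unset Strict Implicit.
Unset Printing Implicit Defensive.

Local Open Scope classical_set_scope.
Local Open Scope card_scope.

(* A cardinal is represented by any set having that cardinality, compared by
   [#<=] and [#=].  The two sets below may live in different types, so the
   larger one is returned as a subset of their disjoint sum. *)
Definition card_max (T U : Type) (A : set T) (B : set U) : set (T + U) :=
  if A #<= B then inr @` B else inl @` A.

Definition omega : set nat := [set: nat].

Definition minimal_dense (Z : topologicalType) (D : set Z) : Prop :=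
  dense D /\ forall E : set Z, dense E -> D #<= E.

(* The density of [Z], represented by a dense subset of least cardinality.  For
   [Y : set X], [dens Y] uses the subspace topology of the library on the
   subtype of elements of [Y]. *)
Definition dens (Z : topologicalType) : set Z :=
  xget [set: Z] [set D : set Z | minimal_dense D].
Arguments dens Z : clear implicits.

Definition up_directed (T : Type) (F : set (set T)) : Prop :=
  F !=set0 /\
  forall A B : set T, F A -> F B -> exists2 C : set T, F C & A `|` B `<=` C.

Definition exceedingly_rich (X : topologicalType) (S : set (set X)) : Prop :=
  [/\ forall A : set X, S A -> closed A,
      forall Y : set X, exists A : set X,
        [/\ S A, Y `<=` A &
            card_max (dens Y) omega #= card_max (dens A) omega]
    & forall F : set (set X), F `<=` S -> up_directed F ->
        S (closure (\bigcup_(A in F) A))].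

Definition Skolem_like (I : Type) (phi : set I -> set I) : Prop :=
  [/\ forall A : set I, A `<=` phi A /\ phi A #<= card_max A omega,
      forall A B : set I, A `<=` B -> phi A `<=` phi B
    & forall F : set (set I), up_directed F ->
        phi (\bigcup_(A in F) A) = \bigcup_(A in F) phi A].

Definition Skolem_large (X : topologicalType) (S : set (set X)) : Prop :=
  exists phi : set X -> set X,
    Skolem_like phi /\ S = [set closure (phi C) | C in [set: set X]].

Definition metrizable (X : topologicalType) : Prop :=
  exists (R : realType) (M : metricType R) (f : X -> M) (g : M -> X),
    [/\ cancel f g, cancel g f, continuous f & continuous g].

(* A nonempty family of sets has a member of least cardinality. *)
Lemma card_min_exists (T : Type) (P : set (set T)) : P !=set0 ->
  exists2 D : set T, P D & forall E : set T, P E -> D #<= E.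
Proof.
move=> [D0 PD0].
have [D00|/set0P[x0 _]] := eqVneq D0 set0.
  by exists D0 => // E _; rewrite D00 card_ge0.
(* Zorn on sets of choice functions that pairwise differ at every coordinate *)
pose good (f : set T -> T) := forall E, P E -> E (f E).
pose ok (G : set (set T -> T)) := G `<=` good /\
  forall f g, G f -> G g -> forall E, P E -> f E = g E -> f = g.
have [G [[Ggood Ginj] Gmax]] : exists G, ok G /\
    forall H, G `<` H -> ~ ok H.
  apply: (@Zorn_bigcup _ [set G | ok G]) => F okF totF; split.
    by move=> f [G FG Gf]; have [gG _] := okF _ FG; exact: gG f Gf.
  move=> f g [G1 FG1 G1f] [G2 FG2 G2g] E PE fg.
  have [G12|G21] := totF _ _ FG1 FG2.
    by have [_ iG2] := okF _ FG2; exact: iG2 (G12 _ G1f) G2g E PE fg.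
  by have [_ iG1] := okF _ FG1; exact: iG1 G1f (G21 _ G2g) E PE fg.
have [D PD surj] : exists2 D, P D & forall x, D x -> exists2 f, G f & f D = x.
  apply: contrapT => nsurj.
  have miss E : exists x, P E -> E x /\ forall f, G f -> f E <> x.
    have [PE|nPE] := pselect (P E); last by exists x0.
    apply: contrapT => nx; apply: nsurj; exists E => // x Ex.
    apply: contrapT => nf; apply: nx; exists x => _; split=> // f Gf fE.
    by apply: nf; exists f.
  have [h hP] := choice miss.
  apply: (Gmax (G `|` [set h])).
    split; first by move=> f Gf; left.
    by move=> sub; have /(_ h) := (hP D0 PD0).2; apply => //; apply: sub; right.
  split=> [f [Gf|-> E PE]|f g [Gf|->] [Gg|->] E PE]; first exact: Ggood.
  - exact: (hP E PE).1.
  - exact: Ginj.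
  - by move=> fg; have := (hP E PE).2 f Gf.
  - by move=> /esym fg; have := (hP E PE).2 g Gg.
  - by [].
exists D => // E PE.
have {surj} /choice[s sP] : forall x, exists f, D x -> G f /\ f D = x.
  move=> x; have [Dx|nDx] := pselect (D x); last by exists (fun=> x).
  by have [f Gf fD] := surj x Dx; exists f.
have : set_inj D (fun x => s x E).
  move=> x y /set_mem Dx /set_mem Dy sxy.
  have [Gx <-] := sP x Dx; have [Gy <-] := sP y Dy.
  by rewrite (Ginj _ _ Gx Gy E PE sxy).
move=> /inj_card_eq imD; rewrite -(card_le_eql imD).
apply: subset_card_le => _ [x Dx <-].
by have [Gx _] := sP x Dx; exact: Ggood Gx E PE.
Qed.

(* The default value of [xget] in [dens] is never used. *)
Lemma densP (Z : topologicalType) : minimal_dense (dens Z).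
Proof.
rewrite /dens; case: xgetP => [D _ //|noD].
have [|D dD minD] := @card_min_exists Z [set D | dense D].
  by exists setT => O O0 _; rewrite setIT.
by have := noD D (conj dD minD).
Qed.

(* Main.v *)
Require Import Defs.
From mathcomp Require Import all_boot all_order all_algebra.
From mathcomp Require Import all_classical all_reals topology.
From mathcomp Require Import wochoice.

Local Open Scope classical_set_scope.
Local Open Scope card_scope.

(* (1) By (R-a) every countable set has a countable superset whose closure lies
   in [S].  Iterating this over finite sequences [s] of points gives countable
   sets [D n s], increasing in [n] and [s], with closures in [S]; then [phi A] is
   the union of all [D n s] with [s] in [A], and its closure lies in [S] by (R-b).
   (2) A metrizable space has a base [U] that is a countable union of disjoint
   families.  Label each basic set by a point close to it, and let [C Z] be the
   set of labels of the basic sets meeting [Z].  As basic sets are open, [C] does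
   not distinguish [Z] from its closure and commutes with unions; disjointness
   gives [|C Z| <= max (dens Z) omega]; and [Z] is contained in the closure of
   [C Z].  The closed sets [Z] with [Z = closure (phi (C Z))] form [S0]. *)

(** * Cardinal arithmetic *)

Lemma card_le_of_inj (T U : Type) (A : set T) (B : set U) (f : T -> U) :
  (forall x, A x -> B (f x)) ->
  (forall x y, A x -> A y -> f x = f y -> x = y) -> A #<= B.
Proof.
move=> fAB finj.
have [] : $|{injfun A >-> B}|; last by move=> g; exact: inj_card_le g.
apply/injfunPex; exists f; first exact: fAB.
by move=> x y /set_mem Ax /set_mem Ay; exact: finj.
Qed.

Lemma card_le_exists_inj (T U : Type) (u0 : U) (A : set T) (B : set U) :
  A #<= B -> exists f : T -> U, (forall x, A x -> B (f x)) /\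
    (forall x y, A x -> A y -> f x = f y -> x = y).
Proof.
move=> /card_leP[g].
have /injfunPex[f fAB finj] : $|{injfun A >-> B}| by squash (valLR u0 g).
exists f; split=> // x y Ax Ay; apply: finj; exact: mem_set.
Qed.

Lemma card_leX (T T' U U' : Type) (A : set T) (A' : set T') (B : set U)
    (B' : set U') : A #<= B -> A' #<= B' -> A `*` A' #<= B `*` B'.
Proof.
have [->|/set0P[a0 Aa0]] := eqVneq A set0; first by rewrite set0X.
have [->|/set0P[a0' Aa0']] := eqVneq A' set0; first by rewrite setX0.
move=> AB AB'.
have [b0 _] : B !=set0.
  apply/set0P; apply: contraPneq Aa0 => B0.
  by move: AB; rewrite B0 => /card_le0P ->.
have [b0' _] : B' !=set0.
  apply/set0P; apply: contraPneq Aa0' => B0.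
  by move: AB'; rewrite B0 => /card_le0P ->.
have [f [fB fi]] := card_le_exists_inj _ _ b0 _ _ AB.
have [f' [fB' fi']] := card_le_exists_inj _ _ b0' _ _ AB'.
apply: (@card_le_of_inj _ _ _ _ (fun p => (f p.1, f' p.2))).
  by move=> [x y] [/= Ax Ay]; split; [exact: fB|exact: fB'].
move=> [x y] [x' y'] [/= Ax Ay] [/= Ax' Ay'] [/fi-> // /fi'-> //].
Qed.

(** A point goes to the pair made of the code of one chosen index whose set contains it and its own
    code in that set; this injects the union into [K * K]. *)
Lemma card_bigcup_le (I T U : Type) (K : set U) (D : set I) (F : I -> set T) :
  K `*` K #<= K -> D #<= K -> (forall i, D i -> F i #<= K) ->
  \bigcup_(i in D) F i #<= K.
Proof.
move=> KK DK FK.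
have [->|/set0P[x0 [i0 Di0 Fx0]]] := eqVneq (\bigcup_(i in D) F i) set0 => //.
have [u0 _] : K !=set0.
  apply/set0P; apply: contraPneq Di0 => K0.
  by move: DK; rewrite K0 => /card_le0P ->.
have [d [dK dinj]] := card_le_exists_inj _ _ u0 _ _ DK.
have /choice[g gP] i : exists g : T -> U, D i -> (forall x, F i x -> K (g x)) /\
    (forall x y, F i x -> F i y -> g x = g y -> x = y).
  have [Di|nDi] := pselect (D i); last by exists (fun=> u0).
  by have [g gP] := card_le_exists_inj _ _ u0 _ _ (FK i Di); exists g.
have /choice[idx idxP] x : exists i, (\bigcup_(i in D) F i) x -> D i /\ F i x.
  have [[i Di Fx]|nx] := pselect ((\bigcup_(i in D) F i) x); first by exists i.
  by exists i0.
apply: card_le_trans KK.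
apply: (@card_le_of_inj _ _ _ _ (fun x => (d (idx x), g (idx x) x))).
  move=> x /idxP[Dx Fx]; split=> /=; first exact: dK.
  exact: (gP _ Dx).1.
move=> x y /idxP[Dx Fx] /idxP[Dy Fy] [/(dinj _ _ Dx Dy) ixy].
by rewrite -ixy; apply: (gP _ Dx).2 => //; rewrite ixy.
Qed.

Lemma card_leU (T U : Type) (K : set U) (A B : set T) : infinite_set K ->
  K `*` K #<= K -> A #<= K -> B #<= K -> A `|` B #<= K.
Proof.
move=> Kinf KK AK BK; rewrite -bigcup2E; apply: card_bigcup_le => //.
  exact/infiniteP.
by move=> [|[|]].
Qed.

(** A member of least cardinality of the pair [{A, B}] decides the comparison. *)
Lemma card_le_total (T : Type) (A B : set T) : (A #<= B) || (B #<= A).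
Proof.
have [|D PD minD] := @card_min_exists T [set A; B]; first by exists A; left.
by apply/orP; case: PD minD => -> minD; [left|right]; apply: minD; [right|left].
Qed.

(* Zorn's lemma is applied to total injective relations, not necessarily
   functional, from [B * B] to [B] with [B] included in [A]. *)
Lemma card_setX_infinite (T : Type) (A : set T) :
  infinite_set A -> A `*` A #<= A.
Proof.
move=> Ainf.
have [a0 _] := infinite_setN0 Ainf.
pose dom (G : set (T * T * T)) := [set x | exists z, G (x, x, z)].
pose ok (G : set (T * T * T)) := [/\ dom G `<=` A,
  forall x y, dom G x -> dom G y -> exists z, G (x, y, z),
  forall x y z, G (x, y, z) -> [/\ dom G x, dom G y & dom G z] &
  forall p q z, G (p, z) -> G (q, z) -> p = q].
have [G [[GA Gtot Gdom Ginj] Gmax]] : exists G, ok G /\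
    forall H, G `<` H -> ~ ok H.
  apply: (@Zorn_bigcup _ ok) => F Fok Ftot.
  have domS X : F X -> dom X `<=` dom (\bigcup_(Y in F) Y).
    by move=> FX x [z Xz]; exists z, X.
  have common X Y : F X -> F Y -> exists Z, [/\ F Z, X `<=` Z & Y `<=` Z].
    move=> FX FY; have [XY|YX] := Ftot _ _ FX FY; first by exists Y; split.
    by exists X; split.
  split.
  - move=> x [z [X FX Xz]]; have [XA _ _ _] := Fok _ FX.
    by apply: XA; exists z.
  - move=> x y [z [X FX Xz]] [t [Y FY Yt]].
    have [Z [FZ XZ YZ]] := common _ _ FX FY; have [_ Ztot _ _] := Fok _ FZ.
    have [||w Zw] := Ztot x y; [by exists z; exact: XZ|by exists t; exact: YZ|].
    by exists w, Z.
  - move=> x y z [X FX Xz]; have [_ _ Xd _] := Fok _ FX.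
    by have [? ? ?] := Xd _ _ _ Xz; split; exact: domS FX _ _.
  - move=> p q z [X FX Xz] [Y FY Yz].
    have [Z [FZ XZ YZ]] := common _ _ FX FY; have [_ _ _ Zinj] := Fok _ FZ.
    by apply: Zinj; [exact: XZ Xz|exact: YZ Yz].
pose B := dom G.
have BB : B `*` B #<= B.
  have /choice[f fP] p : exists z, (B `*` B) p -> G (p, z).
    have [[Bx By]|nBp] := pselect ((B `*` B) p); last by exists a0.
    by case: p Bx By => x y /= Bx By; have [z Gz] := Gtot _ _ Bx By; exists z.
  apply: (@card_le_of_inj _ _ _ _ f) => [[x y] /fP/Gdom[]//|p q /fP Gp /fP Gq].
  by move=> fpq; apply: Ginj Gp _; rewrite fpq.
(* If all pairs of [B + C] inject into [C], use this injection on the pairs outside [B * B]. Its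
   values lie outside [B], so they never clash with those of [G], and [G] would extend properly. *)
have noext C : C !=set0 -> C `<=` A `\` B ->
    (B `|` C) `*` (B `|` C) #<= C -> False.
  move=> [c0 Cc0] CAB /(card_le_exists_inj _ _ c0)[g [gC ginj]].
  have nB c : C c -> ~ B c by move=> /CAB[].
  pose H := G `|` [set t | [/\ ((B `|` C) `*` (B `|` C)) t.1,
    ~ (B `*` B) t.1 & t.2 = g t.1]].
  have domH x : dom H x <-> (B `|` C) x.
    split=> [[z [Gz|[/= [Hx _] _ _]]]|[[z Gz]|Cx]] //.
    - by left; exists z.
    - by exists z; left.
    - by exists (g (x, x)); right; split=> //=; [split; right|move=> [/nB]].
  apply: (Gmax H).
    split; first by move=> t Gt; left.
    move=> HG; have /nB[] := Cc0.
    have [z Hz] : dom H c0 by apply/domH; right.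
    by exists z; exact: HG.
  split.
  - by move=> x /domH[/GA//|/CAB[]].
  - move=> x y /domH Dx /domH Dy.
    have [[Bx By]|nBxy] := pselect ((B `*` B) (x, y)).
      by have [z Gz] := Gtot _ _ Bx By; exists z; left.
    by exists (g (x, y)); right; split.
  - move=> x y z [/Gdom[Bx By Bz]|[/= [Hx Hy] _ ->]].
      by split; apply/domH; left.
    by split; apply/domH => //; right; exact: gC.
  - move=> p q z [Gp|[/= Hp _ zp]] [Gq|[/= Hq _ zq]].
    + exact: Ginj Gp Gq.
    + case: p Gp => x y /Gdom[_ _].
      by rewrite zq => /nB[]; exact: gC.
    + case: q Gq => x y /Gdom[_ _].
      by rewrite zp => /nB[]; exact: gC.
    + by apply: ginj => //; rewrite -zp -zq.
(* For finite [B], a countably infinite subset of the complement of [B] in [A] serves as [C]. *)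
have [Bfin|Binf] := pselect (finite_set B).
  have /infiniteP/(card_le_exists_inj _ _ a0)[f [fAB finj]] :
    infinite_set (A `\` B) by exact: infinite_setD.
  have cardC : range f #= [set: nat].
    by apply: inj_card_eq => m n _ _; apply: finj.
  case: (noext (range f)).
  - by exists (f 0%N), 0%N.
  - by move=> _ [n _ <-]; exact: fAB.
  - have BCc : countable (B `|` range f).
      apply: card_leU; first exact: infinite_nat.
      + by rewrite setXTT (card_le_eql card_nat2).
      + exact: finite_set_countable.
      + by rewrite (card_le_eql cardC).
    by rewrite (card_le_eqr cardC); exact: countableX.
(* Either [B] already has the size of [A], or a copy of [B] fits in its complement in [A] and serves
   as [C]. *)
have [AB|BA] := orP (card_le_total _ (A `\` B) B).
  have AleB : A #<= B.
    by rewrite -(setDUK GA) -/B; apply: card_leU.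
  apply: card_le_trans (card_leX _ _ _ _ _ _ _ _ AleB AleB) _.
  by apply: card_le_trans BB _; exact: subset_card_le.
have [f [fAB finj]] := card_le_exists_inj _ _ a0 _ _ BA.
have cardC : f @` B #= B.
  by apply: inj_card_eq => x y /set_mem ? /set_mem ?; exact: finj.
case: (noext (f @` B)).
- by have [b Bb] := infinite_setN0 Binf; exists (f b), b.
- by move=> _ [b Bb <-]; exact: fAB.
- rewrite (card_le_eqr cardC); apply: (card_le_trans _ BB).
  by apply: card_leX; apply: card_leU => //; rewrite (card_le_eql cardC).
Qed.

Lemma infinite_card_max (T : Type) (A : set T) :
  infinite_set (card_max A omega).
Proof.
rewrite /card_max; case: ifPn => [_|]; last first.
  move=> /negP Anc; apply: contra_not Anc => /finite_set_countable.
  by rewrite /countable (card_le_eql (inj_card_eq _)) // => x y _ _ [].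
apply/infiniteP; rewrite (card_le_eqr (inj_card_eq _)) ?card_lexx //.
by move=> x y _ _ [].
Qed.

Lemma card_le_max (T U : Type) (A : set T) (B : set U) :
  A #<= card_max A B.
Proof.
rewrite /card_max; case: ifPn => [AB|_];
  by rewrite (card_le_eqr (inj_card_eq _)) // => x y _ _ [].
Qed.

Lemma card_max_le (T U V : Type) (A : set T) (B : set U) (K : set V) :
  A #<= K -> B #<= K -> card_max A B #<= K.
Proof.
move=> AK BK; rewrite /card_max; case: ifPn => _;
  by rewrite (card_le_eql (inj_card_eq _)) // => x y _ _ [].
Qed.

(** Sequences are split by length, and each length is bounded by induction on the first entry. *)
Lemma card_seq_le (T : eqType) (U : Type) (A : set T) (K : set U) :
  infinite_set K -> A #<= K -> [set s : seq T | [set` s] `<=` A] #<= K.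
Proof.
move=> Kinf AK; have KK := card_setX_infinite _ _ Kinf.
pose L n := [set s : seq T | size s = n /\ [set` s] `<=` A].
have -> : [set s : seq T | [set` s] `<=` A] = \bigcup_n L n.
  by apply/seteqP; split=> [s sA|s [n _ []]//]; exists (size s).
apply: card_bigcup_le => //; first exact/infiniteP.
elim=> [|n IHn] _.
  apply: (@card_le_trans _ _ _ [set [::]]); last first.
    by apply: card_le_trans (iffLR (infiniteP _) Kinf); exact: countable1.
  by apply: subset_card_le => s [/size0nil].
apply: (@card_le_trans _ _ _ (\bigcup_(x in A) [set x :: s | s in L n])).
  apply: subset_card_le => -[[]//|x s [/= [sn] xsA]].
  exists x; first by apply: xsA => /=; rewrite mem_head.
  exists s => //; split=> // y ys; apply: xsA => /=; rewrite inE.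
  by apply/orP; right.
apply: card_bigcup_le => // x _.
by apply: card_le_trans (IHn I); exact: card_image_le.
Qed.

(** * Directed families, closures and densities *)

Lemma up_directed_seq (T : eqType) (F : set (set T)) (s : seq T) :
  up_directed F -> [set` s] `<=` \bigcup_(A in F) A ->
  exists2 A, F A & [set` s] `<=` A.
Proof.
move=> [[A0 FA0] Fdir]; elim: s => [|x s IHs] sF; first by exists A0.
have [|A FA sA] := IHs; first by move=> y ys; apply: sF; rewrite /= inE ys orbT.
have [|B FB Bx] := sF x; first by rewrite /= mem_head.
have [C FC ABC] := Fdir _ _ FA FB; exists C => // y.
by rewrite /= inE => /orP[/eqP ->|/sA Ay]; apply: ABC; [right|left].
Qed.

Lemma up_directed_image (T U : Type) (f : set T -> set U) (F : set (set T)) :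
  (forall A B, A `<=` B -> f A `<=` f B) -> up_directed F ->
  up_directed [set f A | A in F].
Proof.
move=> fmono [[A0 FA0] Fdir]; split; first by exists (f A0), A0.
move=> _ _ [A FA <-] [B FB <-]; have [C FC ABC] := Fdir _ _ FA FB.
exists (f C); first by exists C.
by move=> x [fx|fx]; apply: fmono fx => y ?; apply: ABC; [left|right].
Qed.

Lemma closure_bigcup_closure (X : topologicalType) (I : Type) (D : set I)
    (F : I -> set X) :
  closure (\bigcup_(i in D) closure (F i)) = closure (\bigcup_(i in D) F i).
Proof.
apply/seteqP; split; last first.
  by apply: closureS => x [i Di Fx]; exists i => //; exact: subset_closure.
rewrite [X in _ `<=` X](iffLR (closure_id _)); last exact: closed_closure.
apply: closureS => x [i Di]; apply: closureS => y Fy.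
by exists i.
Qed.

Lemma dens_le (X : topologicalType) (Y E : set X) :
  E `<=` Y -> Y `<=` closure E -> dens Y #<= E.
Proof.
move=> EY YE; have [_ minD] := densP Y.
have: dense (set_val @^-1` E : set Y).
  move=> O [y Oy] [V oV VO]; rewrite -VO in Oy *.
  have [z [Ez Vz]] : E `&` V !=set0.
    by apply: YE; [exact: set_valP|exact: open_nbhs_nbhs].
  by exists (SigSub (mem_set (EY _ Ez))).
move/minD => /card_le_trans; apply.
apply: (card_le_of_inj _ _ _ _ set_val) => // x y _ _.
exact: val_inj.
Qed.

(** Together with [dens_le], this replaces dense subsets of the subtype of [Y] by subsets of [X]. *)
Lemma dens_witness (X : topologicalType) (Y : set X) :
  exists E : set X, [/\ E `<=` Y, Y `<=` closure E & E #<= dens Y].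
Proof.
have [densD _] := densP Y.
exists (set_val @` dens Y); split; last exact: card_image_le.
  by move=> _ [y _ <-]; exact: set_valP.
move=> x Yx V; rewrite nbhsE => -[W [oW Wx] WV].
pose y : Y := SigSub (mem_set Yx).
have [||z [Wz Dz]] := densD (set_val @^-1` W); first by exists y.
  by exists W.
by exists (set_val z); split; [exists z|exact: WV].
Qed.

(** * From exceedingly rich families to Skolem-like functions *)

(** Adding to [Y] a countable dense subset of the closed set given by (R-a) makes the closure equal
    to that set. *)
Lemma rich_countable_hull (X : topologicalType) (S : set (set X)) (Y : set X) :
  exceedingly_rich S -> countable Y ->
  exists Z, [/\ Y `<=` Z, countable Z & S (closure Z)].
Proof.
move=> [Sclosed Sdens _] Yc; have [A [SA YA YAdens]] := Sdens Y.
have [E [EA AE Edens]] := dens_witness _ A.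
exists (Y `|` E); split; first exact: subsetUl.
  apply: card_leU => //; first exact: infinite_nat.
    exact/card_setX_infinite/infinite_nat.
  apply: card_le_trans Edens _.
  apply: card_le_trans (card_le_max _ _ _ omega) _.
  rewrite -(card_le_eql YAdens); apply: card_max_le; last exact: card_lexx.
  apply: card_le_trans Yc; apply: dens_le => //; exact: subset_closure.
suff -> : closure (Y `|` E) = A by [].
apply/seteqP; split; last by apply: subset_trans AE _; apply: closureS; right.
rewrite [X in _ `<=` X](iffLR (closure_id _) (Sclosed _ SA)).
by apply: closureS => x [/YA|/EA].
Qed.

Lemma rich_Skolem_large (X : topologicalType) (S : set (set X)) :
  exceedingly_rich S ->
  exists2 S0 : set (set X), S0 `<=` S & Skolem_large S0.
Proof.
move=> Srich; have [Sclosed _ Sdir] := Srich.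
have /choice[T TP] Y : exists Z, countable Y ->
    [/\ Y `<=` Z, countable Z & S (closure Z)].
  have [Yc|nYc] := pselect (countable Y); last by exists Y.
  by have [Z ZP] := rich_countable_hull _ _ _ Srich Yc; exists Z.
(* Only the entries of a sequence matter here, so [below] is reflexive and cannot carry a recursion;
   the level [n] carries it instead. *)
pose below (s : seq X) := [set t : seq X | [set` t] `<=` [set` s]].
pose step (D : seq X -> set X) s := T ([set` s] `|` \bigcup_(t in below s) D t).
pose D n := iter n step (fun s => T [set` s]).
have seqc (s : seq X) : countable [set` s].
  by apply: finite_set_countable; exact: finite_seq.
have natinf := infinite_nat.
have belowc E s : (forall t, countable (E t)) ->
    countable ([set` s] `|` \bigcup_(t in below s) E t).
  have nat2 := card_setX_infinite _ _ natinf.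
  move=> Ec; apply: card_leU => //; first exact: seqc.
  apply: card_bigcup_le => // [|t _]; last exact: Ec.
  by apply: card_seq_le => //; exact: seqc.
have Dc n s : countable (D n s).
  elim: n s => [|n IHn] s; first by have [] := TP _ (seqc s).
  by have [] := TP _ (belowc _ s IHn).
have DS n s : [set` s] `<=` D n s /\ S (closure (D n s)).
  case: n => [|n]; first by have [] := TP _ (seqc s).
  have [sub _ SD] := TP _ (belowc _ s (Dc n)); split=> //.
  by apply: subset_trans sub; exact: subsetUl.
have Dstep n s t : below s t -> D n t `<=` D n.+1 s.
  move=> st x Dx; have [sub _ _] := TP _ (belowc _ s (Dc n)).
  by apply: sub; right; exists t.
have Dmono m n s t : (m < n)%N -> below s t -> D m t `<=` D n s.
  elim: n => // n IHn; rewrite ltnS leq_eqVlt => /orP[/eqP ->|mn] st.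
    exact: Dstep.
  by apply: subset_trans (IHn mn st) _; exact: Dstep.
pose phi A :=
  \bigcup_(p in [set p : nat * seq X | [set` p.2] `<=` A]) D p.1 p.2.
have phi_mono A B : A `<=` B -> phi A `<=` phi B.
  by move=> AB x [p pA Dx]; exists p => //; exact: subset_trans AB.
have phiS A : S (closure (phi A)).
  rewrite -closure_bigcup_closure.
  have -> : \bigcup_(p in [set p : nat * seq X | [set` p.2] `<=` A])
      closure (D p.1 p.2) = \bigcup_(B in [set closure (D p.1 p.2) | p in
        [set p : nat * seq X | [set` p.2] `<=` A]]) B by rewrite bigcup_image.
  apply: Sdir; first by move=> _ [p _ <-]; exact: (DS _ _).2.
  split; first by exists (closure (D 0%N [::])), (0%N, [::]).
  move=> _ _ [[m s] /= sA <-] [[n t] /= tA <-].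
  (* The level must strictly exceed both [m] and [n], since [Dmono] needs a strict inequality. *)
  exists (closure (D (maxn m n).+1 (s ++ t))).
    exists ((maxn m n).+1, s ++ t) => // x /=.
    by rewrite mem_cat => /orP[/sA|/tA].
  rewrite subUset; split; apply: closureS; apply: Dmono => //.
  - by rewrite ltnS leq_maxl.
  - by move=> x /= xs; rewrite mem_cat xs.
  - by rewrite ltnS leq_maxr.
  - by move=> x /= xt; rewrite mem_cat xt orbT.
exists [set closure (phi C) | C in [set: set X]]; first by move=> _ [C _ <-].
exists phi; split=> //; split=> //.
- move=> A; split.
    move=> x Ax; exists (0%N, [:: x]).
      by move=> y /=; rewrite inE => /eqP ->.
    by apply: (DS _ _).1 => /=; rewrite mem_head.
  have Kinf := infinite_card_max _ A; have KK := card_setX_infinite _ _ Kinf.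
  have natK : [set: nat] #<= card_max A omega by apply/infiniteP.
  have seqK := card_seq_le _ _ _ _ Kinf (card_le_max _ _ A omega).
  apply: card_bigcup_le => //; last first.
    by move=> p _; apply: card_le_trans natK; exact: Dc.
  apply: card_le_trans KK.
  apply: card_le_trans (card_leX _ _ _ _ _ _ _ _ natK seqK).
  by apply: subset_card_le => p pA; split.
(* (S-c) holds because [phi] is finitary: the entries of one finite sequence already lie in a single
   member of [F]. *)
- move=> F Fdir; apply/seteqP; split.
    move=> x [[n s] /= sF Dx]; have [A FA sA] := up_directed_seq _ _ _ Fdir sF.
    by exists A => //; exists (n, s).
  by move=> x [A FA]; apply: phi_mono; exact: bigcup_sup.
Qed.

(** * Sigma-disjoint bases of metrizable spaces *)

Import Order.TTheory GRing.Theory Num.Theory.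

(* [U k x] is the basic set of the [k]-th family labelled by the point [x], which
   need not belong to [U k x]. *)
Definition sigma_disjoint_base (X : topologicalType) (K : Type)
    (U : K -> X -> set X) : Prop :=
  [/\ forall k x, open (U k x),
      forall k x y z, U k x z -> U k y z -> x = y
    & forall z V, nbhs z V -> exists k x, [/\ U k x z, U k x `<=` V & V x]].

(* Stone's construction: for a fixed radius [r n], a point [c] is assigned to the
   least [x], in a well-order, with [c] in the interior of [ball x (r n)]; the
   [m]-th family consists of the [r m]-neighbourhoods of those [c] that lie
   deeper than [2 r m] in that interior. *)
Lemma pseudometric_base (R : realType) (M : pseudoMetricType R) :
  exists U : nat * nat -> M -> set M, sigma_disjoint_base M (nat * nat) U.
Proof.
have [W Wwo] := well_ordering_principle M.
have Wanti x y : W x y -> W y x -> x = y.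
  move=> Wxy Wyx.
  have Wchain : wo_chain W predT by move=> A _; exact: Wwo.
  by apply: (wo_chain_antisymmetric Wchain) => //; apply/andP.
have Wmin (A : set M) : A !=set0 -> exists2 x, A x & forall y, A y -> W x y.
  move=> [x Ax]; have [|t [[At tmin] _]] := Wwo (fun x => `[< A x >]).
    by exists x; exact/asboolP.
  by exists t; [exact/asboolP|move=> y Ay; apply: tmin; exact/asboolP].
pose r (n : nat) : R := (n.+1%:R^-1)%R.
have r_gt0 n : (0 < r n)%R by rewrite invr_gt0.
have r_lt (e : R) : (0 < e)%R -> exists n, (r n + r n < e)%R.
  move=> e0; have [n] := ltr_add_invr (divr_gt0 e0 (ltr0Sn R 1)).
  by rewrite add0r => ne; exists n; rewrite [ltRHS]splitr ltrD.
have r_le n : (r n <= r n + r n)%R by rewrite lerDl ltW.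
have ball_int (x : M) n : (ball x (r n))° x.
  exact: nbhsx_ballx.
pose B n (x : M) := (ball x (r n))°.
exists (fun k x => \bigcup_(c in [set c | [/\ B k.1 x c,
   forall y, B k.1 y c -> W x y &
   ball c (r k.2 + r k.2) `<=` B k.1 x]]) (ball c (r k.2))°); split.
- by move=> k x; apply: bigcup_open => c _; exact: open_interior.
- move=> [n m] x y z /= [c [_ cx cb] /interior_subset cz].
  move=> [d [_ dy db] /interior_subset dz].
  (* Both centres are within [r m] of [z], so each lies in the [2 r m]-ball of the other. Hence each
     is in both interiors, and minimality compares [x] and [y] both ways. *)
  apply: Wanti.
    by apply: cx; apply: db; exact: ball_triangle dz (ball_sym cz).
  by apply: dy; apply: cb; exact: ball_triangle cz (ball_sym dz).
(* The centre is [z] itself. The basic set lies within [r n] of its label [x], which is within [r n]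
   of [z], hence the choice [2 r n < e]. *)
- move=> z V /nbhs_ballP[e /= e0 zeV]; have [n nV] := r_lt _ e0.
  have [|x xz xmin] := Wmin [set x | B n x z].
    by exists z; exact: ball_int.
  have zx : ball z (r n) x by apply: ball_sym; exact: interior_subset xz.
  have /nbhs_ballP[d /= d0 zd] : nbhs z (B n x).
    by apply: open_nbhs_nbhs; split=> //; exact: open_interior.
  have [m md] := r_lt _ d0.
  exists (n, m), x; split=> /=.
  + exists z; last exact: ball_int.
    by split=> //; apply: subset_trans zd; apply: le_ball; exact: ltW.
  + move=> y [c [_ _ cb] /interior_subset cy]; apply: zeV.
    apply: (le_ball (ltW nV)); apply: (ball_triangle zx).
    by apply: interior_subset; apply: cb; exact: le_ball (r_le m) _ cy.
  + by apply: zeV; apply: le_ball zx; apply: le_trans (ltW nV).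
Qed.

Lemma metrizable_base (X : topologicalType) : metrizable X ->
  exists U : nat * nat -> X -> set X, sigma_disjoint_base X (nat * nat) U.
Proof.
move=> [R [M [f [g [fK gK fc gc]]]]].
have [U [Uopen Udisj Ubase]] := pseudometric_base R M.
exists (fun k x => f @^-1` U k (f x)); split.
- by move=> k x; apply: (iffLR (continuousP _) fc).
- by move=> k x y z /= xz yz; apply: (can_inj fK); exact: Udisj xz yz.
- move=> z V zV.
  have gV : nbhs (f z) (g @^-1` V) by apply: gc; rewrite fK.
  have [k [x [xz xV Vx]]] := Ubase _ _ gV.
  exists k, (g x); rewrite /= gK; split=> // y /xV.
  by rewrite /= fK.
Qed.

Definition hits (X : topologicalType) (K : Type) (U : K -> X -> set X)
    (Z : set X) : set X :=
  [set x | exists k, U k x `&` Z !=set0].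

Section SigmaDisjointBase.
Context (X : topologicalType) (K : countType) (U : K -> X -> set X).
Context (Ubase : sigma_disjoint_base X K U).
Local Notation hits := (hits X K U).

Lemma hitsS (A B : set X) : A `<=` B -> hits A `<=` hits B.
Proof. by move=> AB x [k [y [Uy /AB By]]]; exists k, y. Qed.

Lemma hits_closure (Z : set X) : hits (closure Z) = hits Z.
Proof.
have [Uopen _ _] := Ubase.
apply/seteqP; split; last by apply: hitsS; exact: subset_closure.
move=> x [k [y [Uy Zy]]]; exists k.
by have [|z [Zz Uz]] := Zy (U k x); [exact: open_nbhs_nbhs|exists z].
Qed.

Lemma hits_bigcup (I : Type) (D : set I) (F : I -> set X) :
  hits (\bigcup_(i in D) F i) = \bigcup_(i in D) hits (F i).
Proof.
apply/seteqP; split; last first.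
  by move=> x [i Di]; apply: hitsS; exact: bigcup_sup.
by move=> x [k [y [Uy [i Di Fy]]]]; exists i => //; exists k, y.
Qed.

(** Each point lies in at most one member of each of the countably many families, so it contributes
    only countably many labels. *)
Lemma card_hits (T : Type) (Z : set X) (L : set T) :
  infinite_set L -> Z #<= L -> hits Z #<= L.
Proof.
move=> Linf ZL; have LL := card_setX_infinite _ _ Linf.
have [_ Udisj _] := Ubase; have natL := iffLR (infiniteP _) Linf.
apply: (@card_le_trans _ _ _
    (\bigcup_k \bigcup_(z in Z) [set x | U k x z])).
  by apply: subset_card_le => x [k [z [Uz Zz]]]; exists k => //; exists z.
apply: card_bigcup_le => // [|k _].
  by apply: card_le_trans natL; exact: countableP.
apply: card_bigcup_le => // z _; apply: card_le_trans natL.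
(* A constant map is injective here, as at most one label is involved. *)
apply: (card_le_of_inj _ _ _ _ (fun=> 0%N)) => // x y Ux Uy _.
exact: Udisj Ux Uy.
Qed.

Lemma subset_closure_hits (Z : set X) : Z `<=` closure (hits Z).
Proof.
have [_ _ Unbhs] := Ubase; move=> z Zz V /Unbhs[k [x [Uz _ Vx]]].
by exists x; split=> //; exists k, z.
Qed.

(** Density is not monotone in arbitrary spaces. Here, every basic set meeting [Y] also meets the
    dense subset [E] of [Z], so one point of [Y] chosen from each such set gives a dense subset of
    [Y]. *)
Lemma dens_subset_le (T : Type) (Y Z : set X) (L : set T) :
  infinite_set L -> Y `<=` Z -> dens Z #<= L -> dens Y #<= L.
Proof.
move=> Linf YZ ZL; have [E [_ ZE EZ]] := dens_witness _ Z.
have [Uopen _ Unbhs] := Ubase; have LL := card_setX_infinite _ _ Linf.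
have /choice[p pP] (kx : K * X) : exists y, U kx.1 kx.2 `&` Y !=set0 ->
    (U kx.1 kx.2 `&` Y) y.
  have [[y Uy]|nU] := pselect (U kx.1 kx.2 `&` Y !=set0); first by exists y.
  by exists kx.2.
pose P := \bigcup_k [set p (k, x) | x in hits E].
(* Intersecting with [Y] discards the default values of [p], coming from basic sets that miss
   [Y]. *)
apply: (@card_le_trans _ _ _ (P `&` Y)).
  apply: dens_le; first exact: subIsetr.
  move=> y Yy V /Unbhs[k [x [Uy UV _]]].
  have [|Upy Ypy] := pP (k, x); first by exists y.
  exists (p (k, x)); split; last exact: UV.
  split=> //; exists k => //; exists x => //; exists k.
  have [|z [Ez Uz]] := ZE _ (YZ _ Yy) (U k x); first exact: open_nbhs_nbhs.
  by exists z.
apply: card_le_trans (subset_card_le (@subIsetl _ _ _)) _.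
apply: card_bigcup_le => // [|k _].
  by apply: card_le_trans (iffLR (infiniteP _) Linf); exact: countableP.
apply: card_le_trans (card_image_le _ _) _.
by apply: card_hits => //; exact: card_le_trans ZL.
Qed.

End SigmaDisjointBase.

(** * From Skolem-like functions to exceedingly rich families *)

Lemma Skolem_large_rich (X : topologicalType) (S : set (set X)) :
  metrizable X -> Skolem_large S ->
  exists2 S0 : set (set X), S0 `<=` S & exceedingly_rich S0.
Proof.
move=> /metrizable_base[U Ubase] [phi [[phi_ext phi_mono phi_dir] ->]].
pose C := hits X _ U; pose S0 := [set Z | Z = closure (phi (C Z))].
exists S0; first by move=> Z ->; exists (C Z).
split.
- by move=> Z ->; exact: closed_closure.
- move=> Y; have [D [DY YD Ddens]] := dens_witness _ Y.
  (* Alternating [phi] and [C] from a dense subset of [Y] yields a union [W] stable under both,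
     without exceeding the cardinal [L]. *)
  pose E n := iter n (fun A => phi (A `|` C A)) D.
  pose L := card_max (dens Y) omega.
  have Linf : infinite_set L := infinite_card_max _ _.
  have LL := card_setX_infinite _ _ Linf.
  have natL : omega #<= L by apply/infiniteP.
  have EL n : E n #<= L.
    elim: n => [|n IHn]; first exact: card_le_trans Ddens (card_le_max _ _ _ _).
    apply: card_le_trans (phi_ext _).2 _; apply: card_max_le => //.
    by apply: card_leU => //; exact: card_hits Ubase _ _ _ Linf IHn.
  have ES n : E n `|` C (E n) `<=` E n.+1 by exact: (phi_ext _).1.
  have Emono m n : (m <= n)%N -> E m `<=` E n.
    elim: n => [|n IHn]; first by rewrite leqn0 => /eqP ->.
    rewrite leq_eqVlt => /orP[/eqP -> //|/IHn mn].
    by apply: subset_trans mn _; apply: subset_trans (ES n); exact: subsetUl.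
  pose W := \bigcup_n E n.
  have phiW : phi W `<=` W.
    (* The sets [E n] form an increasing chain, so (S-c) gives the stability of [W] under [phi]. *)
    rewrite /W -(bigcup_image _ E id) phi_dir.
      rewrite !bigcup_image => x [n _ phix]; exists n.+1 => //.
      by apply: phi_mono phix; exact: subsetUl.
    split; first by exists (E 0%N), 0%N.
    move=> _ _ [m _ <-] [n _ <-].
    exists (E (maxn m n)); first by exists (maxn m n).
    by rewrite subUset; split; apply: Emono; rewrite ?leq_maxl ?leq_maxr.
  have CW : C (closure W) `<=` W.
    rewrite /C hits_closure // hits_bigcup // => x [n _ Cx].
    by exists n.+1 => //; apply: ES; right.
  have YW : Y `<=` closure W.
    by apply: subset_trans YD _; apply: closureS => x Dx; exists 0%N.
  exists (closure W); split=> //.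
    apply/seteqP; split; last first.
      by apply: closureS; apply: subset_trans phiW; exact: phi_mono.
    rewrite [X in _ `<=` X](iffLR (closure_id _)); last exact: closed_closure.
    apply: closureS; apply: subset_trans (@subset_closure _ _) _.
    apply: subset_trans (subset_closure_hits _ _ _ Ubase _) _.
    by apply: closureS; exact: (phi_ext _).1.
  (* One inequality is monotonicity of density under [Y] in [closure W]; the other holds because [W]
     is dense in [closure W] and has size at most [L]. *)
  apply/card_eqPle; split; apply: card_max_le.
  + apply: (dens_subset_le _ _ _ Ubase _ _ (closure W)) => //.
      exact: infinite_card_max.
    exact: card_le_max.
  + exact/infiniteP/infinite_card_max.
  + apply: (@card_le_trans _ _ _ W).
      by apply: dens_le; [exact: subset_closure|].
    by apply: card_bigcup_le => // n _; exact: EL.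
  + exact: natL.
(* For (R-b), [C] ignores the closure and commutes with the union, (S-c) moves [phi] inside, and
   each member of [F] is the closure of its own term. *)
- move=> F FS0 Fdir; rewrite /S0 /= /C hits_closure // hits_bigcup //.
  rewrite -(bigcup_image F (hits X _ U) id) phi_dir; last first.
    by apply: up_directed_image => //; exact: hitsS.
  rewrite bigcup_image -[RHS]closure_bigcup_closure; congr closure.
  by apply: eq_bigcupr; exact: FS0.
Qed.

Theorem theorem3 (X : topologicalType) (S : set (set X))
    (S_closed : forall A : set X, S A -> closed A) :
  (exceedingly_rich S ->
    exists2 S0 : set (set X), S0 `<=` S & Skolem_large S0) /\
  (metrizable X -> Skolem_large S ->
    exists2 S0 : set (set X), S0 `<=` S & exceedingly_rich S0).
Proof.
by split; [exact: rich_Skolem_large|exact: Skolem_large_rich].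
Qed.
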